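(* Let $A$ be a $G$-algebra over a field, let $S=[f_1,\ldots,f_k]$ be a left Ore set in $A$, let $I$ be a left ideal in $A$ and let $z\in Z(A)\cap S$. Then $I^{[z]}=I:z^\infty$ is computable, and $I^{[z]}\subseteq I^S$. The equality $I^{[z]}=I^S$ holds if $\mathrm{LSat}(S)=\mathrm{LSat}([z])$, and this condition is equivalent to $f_j\in\mathrm{LSat}([z])$ for all $j\in\{1,\ldots,k\}$. A sufficient condition for this is that $f_1,\ldots,f_k$ commute pairwise and $z$ is a multiple of $f_1\cdots f_k$.
   Context: A $G$-algebra over a field $K$ is a $K$-algebra $A=K\langle z_1,\ldots,z_N\mid z_jz_i=c_{ij}z_iz_j+d_{ij},\ 1\le i<j\le N\rangle$ with $c_{ij}\in K\setminus\{0\}$ and $d_{ij}$ a $K$-linear combination of standard monomials $z_1^{\alpha_1}\cdots z_N^{\alpha_N}$, such that the standard monomials form a $K$-basis of $A$ and there is an admissible (translation-invariant total, with least element $0$) ordering on $\mathbb{N}_0^N$ for which, for all $i<j$, either $d_{ij}=0$ or the leading exponent of $d_{ij}$ is smaller than that of $z_iz_j$. $G$-algebras are left and right Noetherian domains, and kernels of homomorphisms of finitely presented left modules over them, as well as equality of submodules, are computable by Gröbner bases. $Z(A)$ is the center of $A$. $[B]$ denotes the multiplicative monoid of all finite products of elements of $B$ (the empty product being $1$). A left Ore set $S$ is a subset with $1\in S$, $0\notin S$, closed under multiplication, such that for all $s\in S$, $a\in A$ there are $\tilde s\in S$, $\tilde a\in A$ with $\tilde s a=\tilde a s$. For a left Ore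 set $S$: $\mathrm{LSat}(S)=\{a\in A\mid\exists\, w\in A:\ wa\in S\}$, and $I^S=\{a\in A\mid\exists\, s\in S:\ sa\in I\}$ is the $S$-closure of the left ideal $I$. For $q\in Z(A)$: $I:q^\infty=\{a\in A\mid\exists\, n\in\mathbb{N}_0:\ q^na\in I\}$. *)

(* Defs.v *)
From HB Require Import structures.
From mathcomp Require Import all_boot all_order all_algebra.
From mathcomp Require Import boolp classical_sets.
From mathcomp Require Import mpoly.

Set Implicit Arguments.
Unset Strict Implicit.
Unset Printing Implicit Defensive.

Import GRing.Theory.
Local Open Scope ring_scope.
Local Open Scope classical_set_scope.

(* Exponent vectors are multinomials 'X_{1..N}, and {mpoly K[N]} serves only as
   the space of formal K-linear combinations of them: its product is not used.
   The product below is taken in the order x_1^m_1 ... x_N^m_N. *)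
Definition std_mon (K : fieldType) (A : algType K) (N : nat) (x : 'I_N -> A)
    (m : 'X_{1..N}) : A :=
  \prod_(i < N) x i ^+ m i.

Definition std_eval (K : fieldType) (A : algType K) (N : nat) (x : 'I_N -> A)
    (p : {mpoly K[N]}) : A :=
  \sum_(m <- msupp p) p@_m *: std_mon x m.

Definition G_relations (K : fieldType) (N : nat) (c : 'I_N -> 'I_N -> K)
    (d : 'I_N -> 'I_N -> {mpoly K[N]}) (B : algType K) (y : 'I_N -> B) : Prop :=
  forall i j : 'I_N, (i < j)%N ->
    y j * y i = c i j *: (y i * y j) + std_eval y (d i j).

Definition admissible_order (N : nat) (le : rel 'X_{1..N}) : Prop :=
  [/\ antisymmetric le, transitive le, total le,
      forall m, le 0%MM m
    & forall m1 m2 m, le m1 m2 -> le (m1 + m)%MM (m2 + m)%MM].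

Definition is_lead (K : fieldType) (N : nat) (le : rel 'X_{1..N})
    (p : {mpoly K[N]}) (m : 'X_{1..N}) : Prop :=
  m \in msupp p /\ {in msupp p, forall m', le m' m}.

(* [Gpresent_univ] is the universal property of K<x_1, ..., x_N | relations>.
   Only targets with 1 != 0 occur in [algType K]; every algebra maps uniquely
   to the zero algebra, so nothing is lost. *)
Record G_algebra (K : fieldType) (A : algType K) (N : nat) (x : 'I_N -> A)
    (c : 'I_N -> 'I_N -> K) (d : 'I_N -> 'I_N -> {mpoly K[N]}) : Prop := {
  Gcoef_neq0 : forall i j : 'I_N, (i < j)%N -> c i j != 0;
  Gpresent_rel : G_relations c d x;
  Gpresent_univ : forall (B : algType K) (y : 'I_N -> B), G_relations c d y ->
    exists phi : {lrmorphism A -> B}, (forall i, phi (x i) = y i) /\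
      (forall psi : {lrmorphism A -> B}, (forall i, psi (x i) = y i) ->
        psi =1 phi);
  Gbasis : bijective (std_eval x);
  Gorder : exists2 le : rel 'X_{1..N}, admissible_order le &
    forall i j : 'I_N, (i < j)%N ->
      d i j = 0 \/
      exists2 m, is_lead le (d i j) m &
        le m (U_(i) + U_(j))%MM && (m != (U_(i) + U_(j))%MM)
}.

Section LeftOre.
Variable A : nzRingType.
Implicit Types (B S I : set A) (z : A).

Definition center : set A := [set z | forall a : A, GRing.comm z a].

Definition monoid_gen B : set A :=
  [set a | exists2 s : seq A, (forall b, b \in s -> B b) & a = \prod_(b <- s) b].

Definition left_ore S : Prop :=
  [/\ S 1, ~ S 0, forall s t, S s -> S t -> S (s * t)
    & forall s a, S s -> exists s' a' : A, S s' /\ s' * a = a' * s].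

Definition LSat S : set A := [set a | exists w : A, S (w * a)].

Definition left_ideal I : Prop :=
  [/\ I 0, forall a b, I a -> I b -> I (a + b) & forall r a, I a -> I (r * a)].

Definition S_closure S I : set A := [set a | exists2 s, S s & I (s * a)].

Definition saturation I z : set A := [set a | exists n : nat, I (z ^+ n * a)].

Definition lideal_gen n (g : 'cV[A]_n) : set A :=
  [set a | exists h : 'I_n -> A, a = \sum_(i < n) h i * g i 0].

(* Left submodule of A^n generated by the rows of V. *)
Definition rowspan p n (V : 'M[A]_(p, n)) : set 'rV[A]_n :=
  [set v | exists x : 'rV[A]_p, v = x *m V].

(* A kernel oracle receives a homomorphism A^m / rowspan U -> A^n / rowspan V
   of finitely presented left modules, given by v |-> v *m F, and returns rows
   whose classes modulo rowspan U generate its kernel. *)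
Definition kernel_fun : Type :=
  forall r m p n, 'M[A]_(r, m) -> 'M[A]_(m, n) -> 'M[A]_(p, n) ->
    {q : nat & 'M[A]_(q, m)}.

Definition kernel_oracle (ker : kernel_fun) : Prop :=
  forall r m p n (U : 'M[A]_(r, m)) (F : 'M[A]_(m, n)) (V : 'M[A]_(p, n)),
    rowspan (U *m F) `<=` rowspan V ->
    rowspan (col_mx (projT2 (ker r m p n U F V)) U)
      = [set v | rowspan V (v *m F)].

End LeftOre.
Arguments center A : clear implicits.

(* Computability over G-algebras is relative to the two Groebner basis
   procedures: kernels of homomorphisms of finitely presented left modules, and
   equality of submodules.  The model is Jones' WHILE language on binary trees,
   with elements of A as additional leaves and with the ring operations of A
   and these two procedures as additional instructions.  Programs are pure
   syntax, so that no noncomputable function can be smuggled into them. *)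
Inductive data (A : Type) : Type :=
| DNil
| DAtom of A
| DPair of data A & data A.
Arguments DNil {A}.

Inductive prog : Type :=
| PId
| PNil
| PFst
| PSnd
| PPair of prog & prog
| PComp of prog & prog           (* PComp p q: first q, then p *)
| PIf of prog & prog & prog
| PWhile of prog & prog          (* PWhile p q: while p, do q *)
| POne
| PSub
| PMul
| PKer
| PEqSub.

Definition dtrue (A : Type) (u : data A) : bool :=
  if u is DNil then false else true.

Definition enc_nat (A : Type) (n : nat) : data A := iter n (DPair DNil) DNil.

Definition enc_seq (A : Type) (s : seq (data A)) : data A :=
  foldr (@DPair A) DNil s.

Definition enc_mx (A : Type) m n (M : 'M[A]_(m, n)) : data A :=
  DPair (enc_nat A m) (DPair (enc_nat A n)
    (enc_seq [seq enc_seq [seq DAtom (M i j) | j <- enum 'I_n]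
             | i <- enum 'I_m])).

(* [eval ker p u v]: run on u, the program p halts with result v.
   The language is deterministic once [ker] is fixed. *)
Inductive eval (A : nzRingType) (ker : kernel_fun A) :
    prog -> data A -> data A -> Prop :=
| EId u : eval ker PId u u
| ENil u : eval ker PNil u DNil
| EFst u v : eval ker PFst (DPair u v) u
| ESnd u v : eval ker PSnd (DPair u v) v
| EPair p q u v w :
    eval ker p u v -> eval ker q u w -> eval ker (PPair p q) u (DPair v w)
| EComp p q u v w :
    eval ker q u v -> eval ker p v w -> eval ker (PComp p q) u w
| EIf p q1 q2 u b v :
    eval ker p u b -> eval ker (if dtrue b then q1 else q2) u v ->
    eval ker (PIf p q1 q2) u v
| EWhileStop p q u b :
    eval ker p u b -> ~~ dtrue b -> eval ker (PWhile p q) u u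
| EWhileStep p q u b v w :
    eval ker p u b -> dtrue b -> eval ker q u v ->
    eval ker (PWhile p q) v w -> eval ker (PWhile p q) u w
| EOne u : eval ker POne u (DAtom 1)
| ESub a b : eval ker PSub (DPair (DAtom a) (DAtom b)) (DAtom (a - b))
| EMul a b : eval ker PMul (DPair (DAtom a) (DAtom b)) (DAtom (a * b))
| EKer r m p n (U : 'M[A]_(r, m)) (F : 'M[A]_(m, n)) (V : 'M[A]_(p, n)) :
    eval ker PKer (DPair (enc_mx U) (DPair (enc_mx F) (enc_mx V)))
      (enc_mx (projT2 (ker r m p n U F V)))
| EEqSubT p q n (U : 'M[A]_(p, n)) (V : 'M[A]_(q, n)) :
    rowspan U = rowspan V ->
    eval ker PEqSub (DPair (enc_mx U) (enc_mx V)) (DPair DNil DNil)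
| EEqSubF p q n (U : 'M[A]_(p, n)) (V : 'M[A]_(q, n)) :
    rowspan U <> rowspan V ->
    eval ker PEqSub (DPair (enc_mx U) (enc_mx V)) DNil.

(* One program computes, for every left ideal J (input as a finite generating
   family) and every central w, a finite generating family of J^[w], whichever
   generators of kernels the oracle returns. *)
Definition closure_computable (A : nzRingType) : Prop :=
  exists p : prog, forall ker : kernel_fun A, kernel_oracle ker ->
    forall (J : set A) (w : A) n (g : 'cV[A]_n),
      J = lideal_gen g -> center A w ->
      exists m (h : 'cV[A]_m),
        eval ker p (DPair (enc_mx g) (DAtom w)) (enc_mx h) /\
        lideal_gen h = S_closure (monoid_gen [set w]) J.

(* Main.v *)
Require Import Defs.
From HB Require Import structures.
From mathcomp Require Import all_boot all_order all_algebra.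
From mathcomp Require Import boolp classical_sets.
From mathcomp Require Import mpoly zify.

Set Implicit Arguments.
Unset Strict Implicit.
Unset Printing Implicit Defensive.

Import GRing.Theory.
Local Open Scope ring_scope.
Local Open Scope classical_set_scope.

(** Both the computability claim and the commuting case rest on one finiteness
    property: a G-algebra is left Noetherian ([G_algebra_noetherian]).

    For the Noetherian property, a word in the generators is, up to a nonzero
    scalar, the standard monomial with the same exponents plus strictly smaller
    terms: swapping two adjacent letters costs the scalar c_ij and a term
    containing d_ij, which is smaller ([word_sim]).  Leading exponents therefore
    add up under multiplication by a standard monomial ([std_mon_lead]).  If an
    ascending chain of left ideals J_n never stabilized, one could choose in
    each difference J_(n+1) - J_n an element of minimal leading exponent m_n.
    By Dickson's lemma m_i divides m_j for some i < j, and subtracting a left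
    multiple of the i-th element from the j-th one gives an element of the same
    difference with a smaller leading exponent, a contradiction
    ([ascending_chain]).

    Computability: for central w, the ideal J : w is the kernel of
    A -> A/J, a |-> aw, so the kernel procedure returns generators of it.
    Iterating J |-> J : w until two consecutive ideals agree yields
    J : w^oo, and the loop ends because the chain J : w^n stabilizes
    ([eval_loop]).

    Saturations: if all f_j lie in LSat [z], with w_j f_j = z^(n_j), then, z
    being central, w_2 w_1 f_1 f_2 = z^(n_1 + n_2), and likewise for longer
    products ([LSat_power_gen]), so S and [z] have the same saturation.  When the
    f_j commute and z = a f_1...f_k, each f_j is a right factor of z.  When
    z = f_1...f_k a, each f_j is a priori only a left factor of z; that it is
    also a right factor of a power of z is a version up to powers of z of the
    fact that one-sided inverses in a Noetherian ring are two-sided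
    ([left_inverse_up_to_center]). *)

(** * Dickson's lemma *)

(** Beyond any index there is one at which u is minimal over the whole tail;
    iterating this choice gives the subsequence. *)
Lemma nondecreasing_subsequence (u : nat -> nat) :
  exists2 phi : nat -> nat, {homo phi : a b / (a < b)%N} &
    {homo u \o phi : a b / (a <= b)%N}.
Proof.
have tail_min k : exists n, (k <= n)%N /\ forall m, (k <= m)%N -> (u n <= u m)%N.
  have ex : exists v, `[< exists2 n, (k <= n)%N & u n = v >].
    by exists (u k); apply/asboolP; exists k.
  case: (ex_minnP ex) => v /asboolP[n kn <-] vmin; exists n; split=> // m km.
  by apply: vmin; apply/asboolP; exists m.
have [g gP] := choice tail_min.
pose phi n := iter n (fun a => g a.+1) (g 0%N).
have phi_lt n : (phi n < phi n.+1)%N by case: (gP (phi n).+1).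
have phiE n : exists2 k, phi n = g k & (k <= phi n)%N.
  case: n => [|n]; first by exists 0%N.
  by exists (phi n).+1; last exact: phi_lt.
exists phi; first by apply: homo_ltn => //; exact: ltn_trans.
apply: homo_leq => //=; first exact: leq_trans.
move=> n; case: (phiE n) => k e kn; rewrite {1}e; case: (gP k) => _; apply.
exact: leq_trans kn (ltnW (phi_lt n)).
Qed.

(** Extract nondecreasing subsequences for one coordinate after the other. *)
Lemma dickson N (m : nat -> 'X_{1..N}) :
  exists i j, (i < j)%N /\ (m i <= m j)%MM.
Proof.
suff [phi phi_lt phi_le] : exists2 phi : nat -> nat,
    {homo phi : a b / (a < b)%N} &
    forall i : 'I_N, (i < N)%N -> {homo (fun n => m (phi n) i) : a b / (a <= b)%N}.
  exists (phi 0%N), (phi 1%N); split; first exact: phi_lt.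
  by apply/mnm_lepP => i; apply: phi_le.
elim: {3}N => [|k [phi phi_lt phi_le]]; first by exists id.
have [kN|Nk] := ltnP k N; last first.
  by exists phi => // i _; apply: phi_le; exact: leq_trans (ltn_ord i) Nk.
have [psi psi_lt psi_le] :=
  nondecreasing_subsequence (fun n => m (phi n) (Ordinal kN)).
exists (phi \o psi) => [a b ab|i]; first exact/phi_lt/psi_lt.
rewrite ltnS leq_eqVlt => /orP[/eqP ik|ik] a b ab; last first.
  by apply: phi_le => //; exact: ltnW_homo.
by have -> : i = Ordinal kN; [exact: val_inj | exact: psi_le].
Qed.

(** * Admissible orderings *)

Section AdmissibleOrder.
Variables (N : nat) (le : rel 'X_{1..N}).
Hypothesis le_adm : admissible_order le.

Definition mlt m m' := le m m' && (m != m').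

Lemma mle_refl m : le m m.
Proof. by case: le_adm => _ _ tot _ _; have := tot m m; rewrite orbb. Qed.

Lemma mle_anti m m' : le m m' -> le m' m -> m = m'.
Proof. by case: le_adm => anti _ _ _ _ h h'; apply: anti; rewrite h. Qed.

Lemma mle_trans m2 m1 m3 : le m1 m2 -> le m2 m3 -> le m1 m3.
Proof. by case: le_adm => _ tr _ _ _; exact: tr. Qed.

Lemma mlt_le_trans m2 m1 m3 : mlt m1 m2 -> le m2 m3 -> mlt m1 m3.
Proof.
move=> /andP[le12 ne12] le23; rewrite /mlt (mle_trans le12) //=.
by apply: contraNneq ne12 => e; rewrite (mle_anti le12) // e.
Qed.

Lemma mle_lt_trans m2 m1 m3 : le m1 m2 -> mlt m2 m3 -> mlt m1 m3.
Proof.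
move=> le12 /andP[le23 ne23]; rewrite /mlt (mle_trans le12) //=.
by apply: contraNneq ne23 => e; rewrite (mle_anti le23) // -e.
Qed.

Lemma mlt_add2 m1 m2 m : mlt m1 m2 -> mlt (m1 + m)%MM (m2 + m)%MM.
Proof.
case: le_adm => _ _ _ _ mono /andP[le12 ne12]; rewrite /mlt mono //=.
by rewrite (can_eq (addmK m)).
Qed.

Lemma mle_dvd m1 m2 : (m1 <= m2)%MM -> le m1 m2.
Proof.
case: le_adm => _ _ _ le0 mono le12.
by rewrite -(submK le12) -[X in le X _]add0m; apply: mono.
Qed.

(** Otherwise there would be an infinite strictly descending sequence, but in
    it some term divides a later one, hence is below it. *)
Lemma mle_min (P : 'X_{1..N} -> Prop) : (exists m, P m) ->
  exists2 m, P m & forall m', P m' -> le m m'.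
Proof.
move=> [m0 Pm0]; apply: contrapT => nomin.
have down (m : {m | P m}) : exists m' : {m | P m}, ~ le (sval m) (sval m').
  apply: contrapT => h; apply: nomin; exists (sval m); first exact: svalP.
  by move=> m' Pm'; apply: contrapT => nle; apply: h; exists (exist _ m' Pm').
have [g gP] := choice down.
pose u n := sval (iter n g (exist _ m0 Pm0)).
have u_nle n : ~ le (u n) (u n.+1) by exact: gP.
have u_desc : {homo u : a b / (a <= b)%N >-> le b a}.
  apply: homo_leq => [|y a b yx zy|n]; first exact: mle_refl.
    exact: mle_trans zy yx.
  case: le_adm => _ _ tot _ _; have /orP[/u_nle //|//] := tot (u n) (u n.+1).
have [i [j [ij /mle_dvd le_ij]]] := dickson u.
by apply: (u_nle i); apply: mle_trans le_ij (u_desc _ _ ij).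
Qed.

Lemma mlt_ind (P : 'X_{1..N} -> Prop) :
  (forall m, (forall m', mlt m' m -> P m') -> P m) -> forall m, P m.
Proof.
move=> step m; apply: contrapT => nPm.
have [m' nPm' m'min] := mle_min (ex_intro (fun m => ~ P m) m nPm).
apply: nPm'; apply: step => m1 /andP[le1 ne1]; apply: contrapT => /m'min le2.
by rewrite (mle_anti le1 le2) eqxx in ne1.
Qed.

Lemma mle_max (s : seq 'X_{1..N}) : s != [::] ->
  exists2 m, m \in s & {in s, forall m', le m' m}.
Proof.
case: le_adm => _ _ tot _ _.
elim: s => // m [_ _|m1 s /(_ isT) [m' m's max] _].
  by exists m; rewrite ?mem_head // => m'; rewrite inE => /eqP->; exact: mle_refl.
have /orP[mm'|m'm] := tot m m'.
  exists m'; first by rewrite inE m's orbT.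
  by move=> m2; rewrite inE => /predU1P[->|/max].
exists m; first exact: mem_head.
move=> m2; rewrite inE => /predU1P[->|/max m2m']; first exact: mle_refl.
exact: mle_trans m2m' m'm.
Qed.

(** * Leading exponents and the Noetherian property *)

Section Filtration.
Variables (K : fieldType) (A : algType K) (x : 'I_N -> A).

Lemma std_evalE p : std_eval x p = mmap (in_alg A) x p.
Proof. by apply: eq_bigr => m _; rewrite mulr_algl. Qed.

Lemma std_evalD p q : std_eval x (p + q) = std_eval x p + std_eval x q.
Proof. by rewrite !std_evalE mmapD. Qed.

Lemma std_evalZ a p : std_eval x (a *: p) = a *: std_eval x p.
Proof.
have [->|a0] := eqVneq a 0.
  by rewrite !scale0r std_evalE mmap0.
rewrite /std_eval scaler_sumr (perm_big _ (msuppZ p a0)).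
by apply: eq_bigr => m _; rewrite mcoeffZ scalerA.
Qed.

Lemma std_evalX m : std_eval x 'X_[m] = std_mon x m.
Proof. by rewrite /std_eval msuppX big_seq1 mcoeffX eqxx scale1r. Qed.

(** The subspace of A spanned by the standard monomials below [m]. *)
Definition lower (m : 'X_{1..N}) (a : A) : Prop :=
  exists2 p, std_eval x p = a & {in msupp p, forall m', mlt m' m}.

Lemma lower0 m : lower m 0.
Proof.
by exists 0; [rewrite std_evalE mmap0 | move=> m'; rewrite msupp0].
Qed.

Lemma lowerD m a b : lower m a -> lower m b -> lower m (a + b).
Proof.
move=> [p <- pm] [q <- qm]; exists (p + q); first exact: std_evalD.
by move=> m' /msuppD_le; rewrite mem_cat => /orP[/pm|/qm].
Qed.

Lemma lowerZ m k a : lower m a -> lower m (k *: a).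
Proof.
move=> [p <- pm]; exists (k *: p); first exact: std_evalZ.
by move=> m' /msuppZ_le/pm.
Qed.

Lemma lower_sum m (I : eqType) (r : seq I) (F : I -> A) :
  {in r, forall i, lower m (F i)} -> lower m (\sum_(i <- r) F i).
Proof.
move=> lF; rewrite big_seq; elim/big_ind: _ => //; first exact: lower0.
exact: lowerD.
Qed.

Lemma lower_weaken m m' a : le m m' -> lower m a -> lower m' a.
Proof. by move=> mm' [p <- pm]; exists p => // m1 /pm /mlt_le_trans; apply. Qed.

Lemma lower_std_mon m m' : mlt m m' -> lower m' (std_mon x m).
Proof.
move=> mm'; exists 'X_[m]; first exact: std_evalX.
by move=> m1; rewrite msuppX inE => /eqP->.
Qed.

(** Equality up to a nonzero scalar in the quotient by [lower m].  In
    particular [sim m a (std_mon x m)] says that [a] has leading exponent [m]. *)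
Definition sim (m : 'X_{1..N}) (a b : A) : Prop :=
  exists2 k : K, k != 0 & lower m (a - k *: b).

Lemma sim_refl m a : sim m a a.
Proof. by exists 1; rewrite ?oner_eq0 // scale1r subrr; exact: lower0. Qed.

Lemma sim_sym m a b : sim m a b -> sim m b a.
Proof.
move=> [k k0 l]; exists k^-1; first by rewrite invr_eq0.
rewrite -[_ - _]opprK opprB -scaleN1r.
have -> : k^-1 *: a - b = k^-1 *: (a - k *: b).
  by rewrite scalerBr scalerA mulVf // scale1r.
exact/lowerZ/lowerZ.
Qed.

Lemma sim_trans m b a b' : sim m a b -> sim m b b' -> sim m a b'.
Proof.
move=> [k k0 l] [k' k'0 l']; exists (k * k'); first by rewrite mulf_neq0.
have -> : a - (k * k') *: b' = (a - k *: b) + k *: (b - k' *: b').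
  by rewrite scalerBr scalerA addrA subrK.
exact/lowerD/lowerZ.
Qed.

Lemma sim_lower m m' a : mlt m m' -> sim m a (std_mon x m) -> lower m' a.
Proof.
move=> mm' [k _ l]; rewrite -(subrK (k *: std_mon x m) a); apply: lowerD.
  by apply: lower_weaken l; case/andP: mm'.
exact/lowerZ/lower_std_mon.
Qed.

Lemma std_eval_lead p : std_eval x p != 0 ->
  exists2 m, m \in msupp p & sim m (std_eval x p) (std_mon x m).
Proof.
move=> p0; have : msupp p != [::] :> seq _.
  by rewrite msupp_eq0; apply: contraNneq p0 => ->; rewrite std_evalE mmap0.
move=> /mle_max [m mp max]; exists m => //; exists p@_m.
  by rewrite -mcoeff_msupp.
exists (p - p@_m *: 'X_[m]).
  by rewrite -scaleNr std_evalD std_evalZ std_evalX scaleNr.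
move=> m' m'in; have [m'm|ne] := eqVneq m' m.
  by rewrite mcoeff_msupp m'm mcoeffB mcoeffZ mcoeffX eqxx mulr1 subrr eqxx in m'in.
rewrite /mlt ne andbT; apply: max; move: m'in.
by rewrite !mcoeff_msupp mcoeffB mcoeffZ mcoeffX [m == m']eq_sym (negPf ne) mulr0 subr0.
Qed.

Lemma lower_lead m a : lower m a -> a != 0 ->
  exists2 m', mlt m' m & sim m' a (std_mon x m').
Proof.
move=> [p <- pm] /std_eval_lead [m' /pm m'm h]; by exists m'.
Qed.

Variables (c : 'I_N -> 'I_N -> K) (d : 'I_N -> 'I_N -> {mpoly K[N]}).
Hypothesis c_neq0 : forall i j : 'I_N, (i < j)%N -> c i j != 0.
Hypothesis x_rel : G_relations c d x.
Hypothesis d_lower : forall i j : 'I_N, (i < j)%N ->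
  {in msupp (d i j), forall m, mlt m (U_(i) + U_(j))%MM}.

Definition word (s : seq 'I_N) : A := \prod_(i <- s) x i.

Definition wdeg (s : seq 'I_N) : 'X_{1..N} := [multinom count_mem i s | i < N].

Definition sorted_word (m : 'X_{1..N}) : seq 'I_N :=
  flatten [seq nseq (m i) i | i <- index_enum 'I_N].

Lemma word_cat s t : word (s ++ t) = word s * word t.
Proof. exact: big_cat. Qed.

Lemma word_sorted m : word (sorted_word m) = std_mon x m.
Proof.
rewrite /word big_flatten big_map; apply: eq_bigr => i _.
by rewrite big_nseq iter_mulr_1.
Qed.

Lemma wdeg_cat s t : wdeg (s ++ t) = (wdeg s + wdeg t)%MM.
Proof. by apply/mnmP => i; rewrite mnmDE !mnmE count_cat. Qed.

Lemma wdeg_sorted m : wdeg (sorted_word m) = m.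
Proof.
apply/mnmP => i; rewrite mnmE count_flatten -map_comp sumnE big_map.
rewrite (bigD1 i) //= count_nseq /= eqxx mul1n big1 ?addn0 // => j ji.
by rewrite count_nseq /= (negPf ji).
Qed.

Lemma wdeg_perm s t : wdeg s = wdeg t -> perm_eq s t.
Proof.
by move=> /mnmP st; apply/allP => i _ /=; have := st i; rewrite !mnmE => ->.
Qed.

Lemma perm_wdeg s t : perm_eq s t -> wdeg s = wdeg t.
Proof. by move=> /permP st; apply/mnmP => i; rewrite !mnmE st. Qed.

Lemma wdeg1 i : wdeg [:: i] = U_(i)%MM.
Proof. by apply/mnmP => j; rewrite mnm1E mnmE /= addn0. Qed.

Section Reordering.
Variable m : 'X_{1..N}.
Hypothesis IH : forall m', mlt m' m ->
  forall s, wdeg s = m' -> sim m' (word s) (std_mon x m').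

(** The relation for x_j x_i turns the difference of the two sides into terms
    c (u x^e v) with e below the exponent of x_i x_j; their total degree is
    below m, so they are covered by the induction hypothesis on m. *)
Lemma swap_lt u v (i j : 'I_N) : (i < j)%N -> wdeg (u ++ j :: i :: v) = m ->
  sim m (word (u ++ [:: j, i & v])) (word (u ++ [:: i, j & v])).
Proof.
move=> ij deg_m; exists (c i j); first exact: c_neq0.
have pairE a b : word (u ++ [:: a, b & v]) = word u * (x a * x b) * word v.
  by rewrite word_cat {2}/word !big_cons !mulrA.
rewrite !pairE x_rel // mulrDr mulrDl -scalerAr -scalerAl addrAC subrr add0r.
rewrite /std_eval mulr_sumr mulr_suml; apply: lower_sum => e /(d_lower ij) e_lt.
rewrite -scalerAr -scalerAl; apply: lowerZ.
rewrite -word_sorted -!word_cat; set s := _ ++ v.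
have s_lt : mlt (wdeg s) m.
  rewrite -deg_m !wdeg_cat wdeg_sorted (wdeg_cat [:: j]) (wdeg_cat [:: i]) !wdeg1.
  have -> : (wdeg u + (U_(j) + (U_(i) + wdeg v)))%MM
      = ((U_(i) + U_(j)) + (wdeg u + wdeg v))%MM.
    by apply/mnmP => l; rewrite !mnmDE; lia.
  have -> : (wdeg u + e + wdeg v)%MM = (e + (wdeg u + wdeg v))%MM.
    by apply/mnmP => l; rewrite !mnmDE; lia.
  exact: mlt_add2.
exact: sim_lower s_lt (IH s_lt erefl).
Qed.

Lemma swap_sim u v (i j : 'I_N) : wdeg (u ++ j :: i :: v) = m ->
  sim m (word (u ++ [:: j, i & v])) (word (u ++ [:: i, j & v])).
Proof.
move=> deg_m; case: (ltngtP i j) => [ij|ji|/val_inj->]; last exact: sim_refl.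
  exact: swap_lt.
apply/sim_sym/swap_lt => //; rewrite -deg_m; apply: perm_wdeg.
by rewrite perm_cat2l; apply: permEl; exact: (perm_catCA [:: _] [:: _]).
Qed.

Lemma move_sim u t v i : wdeg (u ++ i :: t ++ v) = m ->
  sim m (word (u ++ i :: t ++ v)) (word (u ++ t ++ i :: v)).
Proof.
elim: t u => [|j t IHt] u deg_m; first exact: sim_refl.
apply: sim_trans (swap_sim deg_m) _.
have := IHt (rcons u j); rewrite -!cats1 -!catA /=; apply.
rewrite -deg_m; apply: perm_wdeg.
by rewrite perm_cat2l; apply: permEl; exact: (perm_catCA [:: _] [:: _]).
Qed.

(** With the first letter of s added to the prefix, the rest of s is permuted
    into t without that letter, which is then moved to its place in t. *)
Lemma perm_sim u s t : perm_eq s t -> wdeg (u ++ s) = m ->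
  sim m (word (u ++ s)) (word (u ++ t)).
Proof.
elim: s u t => [|i s IHs] u t.
  by rewrite perm_sym => /perm_nilP-> _; exact: sim_refl.
move=> st deg_m; have := perm_mem st i; rewrite mem_head => /esym it.
case/splitPr: it st => t1 t2 st.
have st' : perm_eq s (t1 ++ t2).
  by rewrite -(perm_cons i) (permPl st) (perm_catCA t1 [:: i] t2).
apply: (@sim_trans _ (word (u ++ i :: t1 ++ t2))).
  have := IHs (rcons u i) _ st'; rewrite -!cats1 -!catA /=; exact.
apply: move_sim; rewrite -deg_m; apply: perm_wdeg.
by rewrite perm_cat2l perm_cons perm_sym.
Qed.

End Reordering.

(** Well-founded induction on the degree supplies the hypothesis under which
    letters may be permuted; permuting them into increasing order is enough. *)
Lemma word_sim s : sim (wdeg s) (word s) (std_mon x (wdeg s)).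
Proof.
have [m deg_s] : exists m, wdeg s = m by exists (wdeg s).
rewrite deg_s; elim/mlt_ind: m s deg_s => m IH s deg_s.
rewrite -word_sorted; apply: (perm_sim IH (u := [::])) => //.
by apply: wdeg_perm; rewrite wdeg_sorted.
Qed.

Lemma std_monM m1 m2 :
  sim (m1 + m2)%MM (std_mon x m1 * std_mon x m2) (std_mon x (m1 + m2)%MM).
Proof.
rewrite -!word_sorted -word_cat word_sorted.
by have := word_sim (sorted_word m1 ++ sorted_word m2); rewrite wdeg_cat !wdeg_sorted.
Qed.

Lemma std_mon_lead m1 m2 a : sim m2 a (std_mon x m2) ->
  sim (m1 + m2)%MM (std_mon x m1 * a) (std_mon x (m1 + m2)%MM).
Proof.
move=> [k k0 [p pE p_lt]]; apply: sim_trans (std_monM m1 m2); exists k => //.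
rewrite scalerAr -mulrBr -pE /std_eval mulr_sumr.
apply: lower_sum => m' /p_lt m'_lt; rewrite -scalerAr; apply: lowerZ.
apply: sim_lower (std_monM _ _).
by rewrite [(m1 + m')%MM]addmC [(m1 + m2)%MM]addmC; exact: mlt_add2.
Qed.

Hypothesis std_surj : forall a, exists p, a = std_eval x p.

Lemma exists_lead a : a != 0 -> exists m, sim m a (std_mon x m).
Proof. by have [p ->] := std_surj a => /std_eval_lead[m _ h]; exists m. Qed.

(** Reduction of new elements of minimal leading exponent against each other,
    as in the proof that Groebner bases are finite. *)
Lemma ascending_chain (J : nat -> set A) :
  (forall n, left_ideal (J n)) -> (forall n, J n `<=` J n.+1) ->
  exists n, J n.+1 `<=` J n.
Proof.
move=> Jid Jinc; apply: contrapT => no_stab.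
have J_homo n n' : (n <= n')%N -> J n `<=` J n'.
  elim: n' => [|n' IH]; first by rewrite leqn0 => /eqP->.
  by rewrite leq_eqVlt => /predU1P[->|/IH h a /h /Jinc].
pose lead n m := exists a, [/\ J n.+1 a, ~ J n a & sim m a (std_mon x m)].
(* The least leading exponent among the elements new at stage n+1. *)
have min_lead n : exists m, lead n m /\ forall m', lead n m' -> le m m'.
  suff /mle_min[m ? ?] : exists m, lead n m by exists m.
  have [a Ja nJa] : exists2 a, J n.+1 a & ~ J n a.
    apply: contrapT => h; apply: no_stab; exists n => a Ja.
    by apply: contrapT => nJa; apply: h; exists a.
  have /exists_lead[m am] : a != 0 by apply/eqP => a0; rewrite a0 in nJa; case: (Jid n).
  by exists m, a.
have [m mP] := choice min_lead.
have [i [j [ij m_ij]]] := dickson m.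
have [[a [Ja _ am]] _] := mP i; have [[b [Jb nJb bm]] min_j] := mP j.
have := std_mon_lead (m j - m i)%MM am; rewrite submK // => am'.
(* The left multiple of a by x^(m j - m i) has the leading exponent of b. *)
have [k _ bk] := sim_trans bm (sim_sym am').
set a' := std_mon x _ * a in bk.
have Ja' : J j (k *: a').
  have [_ _ JM] := Jid j; rewrite -mulr_algl; apply/JM/JM.
  exact: J_homo ij _ Ja.
have nJ : ~ J j (b - k *: a').
  by move=> h; apply: nJb; rewrite -(subrK (k *: a') b); case: (Jid j) => _ JD _; exact: JD.
have [|m' m'lt m'P] := lower_lead bk.
  by apply/eqP => e; apply: nJ; rewrite e; case: (Jid j).
have /min_j le_mm' : lead j m'.
  exists (b - k *: a'); split=> //; have [_ JD JM] := Jid j.+1.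
  by apply: JD => //; rewrite -mulN1r; apply: JM; exact: Jinc.
by case/andP: m'lt => le' /eqP; apply; exact: mle_anti.
Qed.

End Filtration.
End AdmissibleOrder.

Definition left_noetherian (A : nzRingType) : Prop :=
  forall J : nat -> set A, (forall n, left_ideal (J n)) ->
    (forall n, J n `<=` J n.+1) -> exists n, J n.+1 `<=` J n.

Lemma G_algebra_noetherian (K : fieldType) (A : algType K) (N : nat)
    (x : 'I_N -> A) c d : G_algebra x c d -> left_noetherian A.
Proof.
move=> [c0 rel _ [g _ gK] [le le_adm lead]] J Jid Jinc.
apply: (ascending_chain le_adm c0 rel) => // [i j ij m|a].
  case: (lead i j ij) => [->|[m0 [_ max] lt0] /max mm0]; first by rewrite msupp0.
  exact: mle_lt_trans mm0 lt0.
by exists (g a); rewrite gK.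
Qed.

(** * Saturation by a central element *)

Section Saturation.
Variable A : nzRingType.
Implicit Types (S T J : set A) (w z : A).

Definition colon J w : set A := [set a | J (w * a)].

Lemma centerX z n : center A z -> center A (z ^+ n).
Proof. by move=> zC a; apply/commr_sym/commrX/commr_sym/zC. Qed.

Lemma monoid_gen1 z : monoid_gen [set z] = [set a | exists n, a = z ^+ n].
Proof.
apply/seteqP; split=> a [].
  move=> s sz ->; exists (size s); elim: s sz => [|b s IHs] sz.
    by rewrite big_nil.
  rewrite big_cons exprS IHs => [|b' b's]; last by apply: sz; rewrite inE b's orbT.
  by rewrite (sz b) ?mem_head.
move=> n ->; exists (nseq n z); first by move=> b /nseqP[].
by rewrite big_nseq iter_mulr_1.
Qed.

Lemma S_closure_saturation J z : S_closure (monoid_gen [set z]) J = saturation J z.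
Proof.
rewrite monoid_gen1; apply/seteqP; split=> a; first by case=> s [n ->]; exists n.
by case=> n Jna; exists (z ^+ n) => //; exists n.
Qed.

Lemma left_ideal_colon J z : left_ideal J -> center A z -> left_ideal (colon J z).
Proof.
move=> [J0 JD JM] zC; split=> [|a b Ja Jb|r a Ja]; rewrite /colon /=.
- by rewrite mulr0.
- by rewrite mulrDr; apply: JD.
- by rewrite mulrA (zC r) -mulrA; apply: JM.
Qed.

Lemma colonX J z n : colon (colon J z) (z ^+ n) = colon J (z ^+ n.+1).
Proof. by apply/seteqP; split=> a; rewrite /colon /= mulrA -exprS. Qed.

Lemma colonX_inc J z n : left_ideal J ->
  colon J (z ^+ n) `<=` colon J (z ^+ n.+1).
Proof. by move=> [_ _ JM] a Ja; rewrite /colon /= exprS -mulrA; apply: JM. Qed.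

(** The stopping criterion of the iteration J |-> J : z. *)
Lemma saturation_stable J z : colon J z `<=` J -> left_ideal J -> saturation J z = J.
Proof.
move=> stab [_ _ JM]; apply/seteqP; split=> a; last by exists 0%N; rewrite mul1r.
by case=> n; elim: n => [|n IHn]; rewrite ?mul1r // exprS -mulrA => /stab.
Qed.

Lemma saturation_colon J z : left_ideal J -> saturation (colon J z) z = saturation J z.
Proof.
move=> [_ _ JM]; apply/seteqP; split=> a [n]; rewrite /colon /=.
  by rewrite mulrA -exprS; exists n.+1.
by move=> Ja; exists n; apply: JM.
Qed.

Lemma colon_stabilizes J z : left_noetherian A -> left_ideal J -> center A z ->
  exists n, colon J (z ^+ n.+1) `<=` colon J (z ^+ n).
Proof.
move=> noeth Jid zC; apply: noeth => n.
  exact/left_ideal_colon/centerX.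
exact: colonX_inc.
Qed.

Lemma left_ideal_gen n (g : 'cV[A]_n) : left_ideal (lideal_gen g).
Proof.
split.
- by exists (fun=> 0); rewrite big1 // => i _; rewrite mul0r.
- move=> a b [h ->] [h' ->]; exists (fun i => h i + h' i).
  by rewrite -big_split; apply: eq_bigr => i _; rewrite mulrDl.
- move=> r a [h ->]; exists (fun i => r * h i).
  by rewrite mulr_sumr; apply: eq_bigr => i _; rewrite mulrA.
Qed.

Lemma rowspan_col n (g : 'cV[A]_n) v : rowspan g v <-> lideal_gen g (v 0 0).
Proof.
split=> [[y ->]|[h e]]; first by exists (y 0); rewrite mxE.
exists (\row_i h i); apply/matrixP => i j; rewrite !ord1 e mxE.
by apply: eq_bigr => l _; rewrite mxE.
Qed.

Lemma lideal_gen_rowspan n (g : 'cV[A]_n) a : lideal_gen g a <-> rowspan g a%:M.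
Proof. by rewrite rowspan_col mxE eqxx. Qed.

Lemma lideal_gen_eq n p (g : 'cV[A]_n) (h : 'cV[A]_p) :
  rowspan g = rowspan h <-> lideal_gen g = lideal_gen h.
Proof.
split=> e; apply/seteqP; split.
- by move=> a /lideal_gen_rowspan; rewrite e => /lideal_gen_rowspan.
- by move=> a /lideal_gen_rowspan; rewrite -e => /lideal_gen_rowspan.
- by move=> v /rowspan_col; rewrite e => /rowspan_col.
- by move=> v /rowspan_col; rewrite -e => /rowspan_col.
Qed.

(** Generators of the kernel of A -> A/(g), a |-> aw.  The presentation of the
    source A is the empty matrix with one column. *)
Definition ker_gens (ker : kernel_fun A) n (g : 'cV[A]_n) w : {q & 'cV[A]_q} :=
  ker 0%N 1%N n 1%N 0 w%:M g.

(** The row vector (a) is sent to (aw), which equals (wa) for central w. *)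
Lemma ker_gensP (ker : kernel_fun A) n (g : 'cV[A]_n) w :
  kernel_oracle ker -> center A w ->
  lideal_gen (projT2 (ker_gens ker g w)) = colon (lideal_gen g) w.
Proof.
move=> kerP wC; have [_ _ gM] := left_ideal_gen g.
have := kerP 0%N 1%N n 1%N 0 w%:M g; rewrite -/(ker_gens ker g w).
move: (ker_gens ker g w) => [q h] /=.
have -> : rowspan (col_mx h (0 : 'M_(0, 1))) = rowspan h.
  apply/seteqP; split=> v [y ->].
    by exists (lsubmx y); rewrite -{1}[y]hsubmxK mul_row_col mulmx0 addr0.
  by exists (row_mx y 0); rewrite mul_row_col mulmx0 addr0.
move=> /(_ _)/seteqP[|hsub subh].
  move=> v [y ->]; rewrite mul0mx mulmx0.
  by apply/rowspan_col; rewrite mxE; case: (left_ideal_gen g).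
have mulw a : (a%:M *m w%:M : 'M_1) 0 0 = w * a.
  by rewrite -scalar_mxM mxE eqxx mulr1n (wC a).
apply/seteqP; split=> a.
  by move=> /lideal_gen_rowspan/hsub/rowspan_col; rewrite mulw.
by move=> ha; apply/lideal_gen_rowspan/subh/rowspan_col; rewrite mulw.
Qed.

End Saturation.

(** * The program *)

(** As data, the number one; as a Boolean, true. *)
Definition prog_one : prog := PPair PNil PNil.

(** On a pair of encodings of g and w: builds the empty matrix with one column
    and the 1x1 matrix w, then calls the kernel procedure. *)
Definition prog_colon : prog :=
  PComp PKer (PPair (PPair PNil (PPair prog_one PNil))
    (PPair (PPair prog_one (PPair prog_one (PPair (PPair PSnd PNil) PNil))) PFst)).

Definition prog_unstable : prog :=
  PIf (PComp PEqSub (PPair PFst prog_colon)) PNil prog_one.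

Definition prog_saturation : prog :=
  PComp PFst (PWhile prog_unstable (PPair prog_colon PSnd)).

Section Program.
Variables (A : nzRingType) (ker : kernel_fun A).

Lemma eval_one u : eval ker prog_one u (enc_nat A 1).
Proof. by apply: EPair; apply: ENil. Qed.

Lemma enum_ord0 : enum 'I_0 = [::].
Proof. by apply: size0nil; rewrite size_enum_ord. Qed.

Lemma enc_mx01 (M : 'M[A]_(0, 1)) : enc_mx M = DPair DNil (DPair (enc_nat A 1) DNil).
Proof. by rewrite /enc_mx enum_ord0. Qed.

Lemma enc_mx11 (M : 'M[A]_1) : enc_mx M = DPair (enc_nat A 1)
  (DPair (enc_nat A 1) (DPair (DPair (DAtom (M 0 0)) DNil) DNil)).
Proof. by rewrite /enc_mx enum_ordSl enum_ord0. Qed.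

Lemma eval_colon n (g : 'cV[A]_n) w : eval ker prog_colon
  (DPair (enc_mx g) (DAtom w)) (enc_mx (projT2 (ker_gens ker g w))).
Proof.
apply: EComp _ (EKer ker 0 w%:M g); rewrite enc_mx01 enc_mx11 mxE eqxx mulr1n.
apply: EPair.
  by apply: EPair; [exact: ENil | apply: EPair; [exact: eval_one | exact: ENil]].
apply: EPair; last exact: EFst.
apply: EPair; first exact: eval_one.
apply: EPair; first exact: eval_one.
apply: EPair; last exact: ENil.
apply: EPair; last exact: ENil.
exact: ESnd.
Qed.

Lemma eval_unstable n (g : 'cV[A]_n) w :
  let g' := projT2 (ker_gens ker g w) in
  exists2 b, eval ker prog_unstable (DPair (enc_mx g) (DAtom w)) b &
    dtrue b <-> rowspan g <> rowspan g'.
Proof.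
move=> g'; have arg : eval ker (PPair PFst prog_colon)
    (DPair (enc_mx g) (DAtom w)) (DPair (enc_mx g) (enc_mx g')).
  by apply: EPair; [exact: EFst | exact: eval_colon].
have [e|ne] := pselect (rowspan g = rowspan g').
  exists DNil => //; apply: EIf (EComp arg (EEqSubT _ e)) _; exact: ENil.
exists (enc_nat A 1) => //; apply: EIf (EComp arg (EEqSubF _ ne)) _.
exact: eval_one.
Qed.

Hypothesis kerP : kernel_oracle ker.

(** Induction on an index k at which the chain J : w^n is known to be stable:
    replacing J by J : w lowers this index by one. *)
Lemma eval_loop k w n (g : 'cV[A]_n) : center A w ->
  colon (lideal_gen g) (w ^+ k.+1) `<=` colon (lideal_gen g) (w ^+ k) ->
  exists m (h : 'cV[A]_m),
    eval ker (PWhile prog_unstable (PPair prog_colon PSnd))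
      (DPair (enc_mx g) (DAtom w)) (DPair (enc_mx h) (DAtom w)) /\
    lideal_gen h = saturation (lideal_gen g) w.
Proof.
move=> wC; elim: k n g => [|k IHk] n g stab;
  have [b test bP] := eval_unstable g w; have gid := left_ideal_gen g;
  have colonE := ker_gensP g kerP wC.
  exists n, g; split; last first.
    rewrite saturation_stable // => a ga.
    by have := stab a; rewrite /colon /= expr0 expr1 mul1r; exact.
  (* For k = 0 the ideal equals its quotient by w, so the test must fail. *)
  apply: EWhileStop _ test _; apply/negP => /bP; apply.
  apply/lideal_gen_eq; rewrite colonE; apply/seteqP; split=> a.
    by case: gid => _ _; exact.
  by have := stab a; rewrite /colon /= expr0 expr1 mul1r.
have [/bP nstab|/negP b_false] := boolP (dtrue b); last first.
  exists n, g; split; first by apply: EWhileStop _ test _; exact/negP.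
  rewrite saturation_stable // -colonE.
  suff /lideal_gen_eq -> : rowspan g = rowspan (projT2 (ker_gens ker g w)) by [].
  by apply: contrapT => /bP.
have [|m [h [loop hE]]] := IHk _ (projT2 (ker_gens ker g w)).
  by rewrite colonE !colonX.
exists m, h; split; last by rewrite hE colonE saturation_colon.
apply: EWhileStep test _ _ loop; first exact/bP.
by apply: EPair; [exact: eval_colon | exact: ESnd].
Qed.

End Program.

Lemma noetherian_closure_computable (A : nzRingType) :
  left_noetherian A -> closure_computable A.
Proof.
move=> noeth; exists prog_saturation => ker kerP J w n g -> wC.
have [k stab] := colon_stabilizes noeth (left_ideal_gen g) wC.
have [m [h [loop hE]]] := eval_loop kerP wC stab.
exists m, h; rewrite S_closure_saturation; split=> //.
by apply: EComp loop _; exact: EFst.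
Qed.

(** * Saturations of multiplicative sets *)

(** In the localization at z, v/z is a right inverse of u.  The left
    annihilators of the powers v^n form an ascending chain of left ideals; once
    it is stable at n, the defect t = vu - z, which satisfies tv = 0, is killed
    by z^n: indeed t u^n v^(n+1) = z^n t v = 0, hence
    z^n t = t u^n v^n = 0. *)
Lemma left_inverse_up_to_center (A : nzRingType) (u v z : A) :
  left_noetherian A -> center A z -> u * v = z ->
  exists n, z ^+ n * (v * u) = z ^+ n.+1.
Proof.
move=> noeth zC uv.
have [|n|n stab] := noeth (fun n => [set r | r * v ^+ n = 0]).
- move=> n; split=> [|a b /= a0 b0|r a /= a0]; first exact: mul0r.
    by rewrite mulrDl a0 b0 addr0.
  by rewrite -mulrA a0 mulr0.
- by move=> r /= r0; rewrite exprSr mulrA r0 mul0r.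
have uvX k : u ^+ k * v ^+ k = z ^+ k.
  elim: k => [|k IHk]; first by rewrite !expr0 mulr1.
  rewrite [u ^+ _]exprSr [v ^+ _]exprS mulrA -[u ^+ k * u * v]mulrA uv.
  by rewrite -(zC (u ^+ k)) -mulrA IHk -exprS.
pose t := v * u - z.
have tv : t * v = 0 by rewrite mulrBl -mulrA uv (zC v) subrr.
exists n; apply/eqP; rewrite exprSr -subr_eq0 -mulrBr -/t (centerX n zC) -uvX mulrA.
apply/eqP/stab; rewrite /= exprSr mulrA -[t * _ * _]mulrA uvX.
by rewrite -(centerX n zC) -mulrA tv mulr0.
Qed.

Section Localization.
Variable A : nzRingType.
Implicit Types (S T J : set A) (a z : A).

Lemma S_closure_power_sub S J z : S 1 -> (forall s t, S s -> S t -> S (s * t)) ->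
  S z -> S_closure (monoid_gen [set z]) J `<=` S_closure S J.
Proof.
move=> S1 SM Sz a; rewrite S_closure_saturation => -[n Jna].
by exists (z ^+ n) => //; elim: {Jna}n => // n IHn; rewrite exprS; apply: SM.
Qed.

Lemma S_closure_LSat S T J : left_ideal J -> S `<=` LSat T ->
  S_closure S J `<=` S_closure T J.
Proof.
move=> [_ _ JM] ST a [s Ss Jsa]; have [w Tws] := ST s Ss.
by exists (w * s) => //; rewrite -mulrA; apply: JM.
Qed.

Lemma sub_LSat S : S `<=` LSat S.
Proof. by move=> s Ss; exists 1; rewrite mul1r. Qed.

Lemma LSat_sub S T : S `<=` LSat T -> LSat S `<=` LSat T.
Proof.
by move=> ST a [w /ST [w' Tww]]; exists (w' * w); rewrite -mulrA.
Qed.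

(** If va = z^n and wb = z^m, then (wv)(ab) = w z^n b = z^(n+m). *)
Lemma LSat_power_mul z a b : center A z -> LSat (monoid_gen [set z]) a ->
  LSat (monoid_gen [set z]) b -> LSat (monoid_gen [set z]) (a * b).
Proof.
rewrite monoid_gen1 => zC [v [n va]] [w [m wb]].
exists (w * v); exists (n + m)%N.
by rewrite mulrA -[w * v * a]mulrA va -(centerX n zC) -mulrA wb exprD.
Qed.

Lemma LSat_power_gen z B : center A z -> B `<=` LSat (monoid_gen [set z]) ->
  monoid_gen B `<=` LSat (monoid_gen [set z]).
Proof.
move=> zC BL a [s sB ->]; rewrite big_seq; elim/big_ind: _ => [|? ?|b /sB/BL //].
  by apply: sub_LSat; rewrite monoid_gen1; exists 0%N.
exact: LSat_power_mul.
Qed.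

Lemma commuting_prod_factor (I : eqType) (r : seq I) (f : I -> A) j :
  (forall i i', GRing.comm (f i) (f i')) -> j \in r ->
  exists2 q, \prod_(i <- r) f i = f j * q & \prod_(i <- r) f i = q * f j.
Proof.
move=> fC; elim: r => // i r IHr; rewrite inE big_cons.
have [<- _|_ /= /IHr[q fq qf]] := eqVneq j i.
  by exists (\prod_(i <- r) f i) => //; apply: commr_prod => l _; apply: fC.
exists (f i * q); first by rewrite fq mulrA (fC i j) -mulrA.
by rewrite qf mulrA.
Qed.

End Localization.

Theorem mainTheorem9 (K : fieldType) (A : algType K) (N : nat) (x : 'I_N -> A)
    (c : 'I_N -> 'I_N -> K) (d : 'I_N -> 'I_N -> {mpoly K[N]})
    (HA : G_algebra x c d)
    (k : nat) (f : 'I_k -> A) (S : set A)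
    (HS : S = monoid_gen [set a | exists j, a = f j]) (S_ore : left_ore S)
    (I : set A) (HI : left_ideal I)
    (z : A) (Hz : (center A `&` S) z) :
  [/\ S_closure (monoid_gen [set z]) I = saturation I z /\ closure_computable A,
      S_closure (monoid_gen [set z]) I `<=` S_closure S I,
      LSat S = LSat (monoid_gen [set z]) ->
        S_closure (monoid_gen [set z]) I = S_closure S I,
      LSat S = LSat (monoid_gen [set z]) <->
        (forall j, LSat (monoid_gen [set z]) (f j))
    & (forall i j, GRing.comm (f i) (f j)) ->
      ((exists a, z = a * \prod_(j < k) f j) \/
       (exists a, z = \prod_(j < k) f j * a)) ->
      LSat S = LSat (monoid_gen [set z])].
Proof.
have noeth := G_algebra_noetherian HA.
have [zC Sz] := Hz; have [S1 _ SM _] := S_ore.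
have closure_sub := S_closure_power_sub (J := I) S1 SM Sz.
have LSat_iff : LSat S = LSat (monoid_gen [set z]) <->
    forall j, LSat (monoid_gen [set z]) (f j).
  split=> [<- j|fL].
    apply: sub_LSat; rewrite HS; exists [:: f j]; last by rewrite big_seq1.
    by move=> b; rewrite inE => /eqP->; exists j.
  apply/seteqP; split; apply: LSat_sub; last first.
    rewrite monoid_gen1 => a [n ->]; apply: sub_LSat.
    by elim: n => // n IHn; rewrite exprS; apply: SM.
  by rewrite HS; apply: LSat_power_gen => // a [j ->].
split=> //.
- by split; [exact: S_closure_saturation | exact: noetherian_closure_computable].
- move=> LSatE; apply/seteqP; split=> //; apply: S_closure_LSat => //.
  by rewrite -LSatE; exact: sub_LSat.
move=> fC z_mult; apply/LSat_iff => j; rewrite monoid_gen1.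
have [q fq qf] := commuting_prod_factor fC (mem_index_enum j).
case: z_mult => [[a za]|[a za]].
  by exists (a * q); exists 1%N; rewrite expr1 za qf mulrA.
have [|n nE] := left_inverse_up_to_center (u := f j) (v := q * a) noeth zC.
  by rewrite mulrA -fq.
by exists (z ^+ n * (q * a)); exists n.+1; rewrite -mulrA.
Qed.
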